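(* Let $k$ be a positive integer and $m$ an odd integer with $1\le m\le 2^k$. Then $$ L(m,2^k)=\begin{cases} 2^{\lfloor k/2\rfloor} & \text{if } m\equiv \pm 1 \bmod 2^{\lceil k/2\rceil};\\ 2^{j+2} & \text{if } m=\pm 1+2^j r \text{ with integers } j, r,\ 2\le j<k/2-1,\ 2\nmid r;\\ 2^{j+1} & \text{if } m=\pm 1+2^j r \text{ with integers } j, r,\ j=k/2-1\ge 2,\ 2\nmid r;\\ 2^{j} & \text{if } m=\pm 1+2^j r \text{ with integers } j, r,\ j=(k-1)/2\ge 2,\ 2\nmid r. \end{cases} $$ Here each condition involving $\pm 1$ means that it holds for at least one choice of the sign.
   Context: For a positive integer $n$ and an integer $m$ with $\gcd(m,n)=1$, define $$ L(m,n)=\bigl|\{x\in\mathbb{Z} : 1\le x\le n,\ \gcd(x,n)=1,\ (x-m)(xm-1)\equiv 0 \bmod n\}\bigr|. $$ *)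

(* Defs.v *)
From mathcomp Require Import all_boot all_order all_algebra.

Set Implicit Arguments.
Unset Strict Implicit.
Unset Printing Implicit Defensive.

Import GRing.Theory Num.Theory.

Local Open Scope ring_scope.

(* The integers 1 <= x <= n are encoded as the nonzero elements of 'I_n.+1.
   The definition is total in m and n; it is meant for n > 0 and m coprime
   to n. *)
Definition L (m : int) (n : nat) : nat :=
  #|[set x : 'I_n.+1 | [&& (1 <= x)%N, coprime x n
       & ((x%:Z - m) * (x%:Z * m - 1) == 0 %[mod n%:Z])%Z]]|.

(* For at least one choice of the sign, m = +-1 + 2^j r with r odd. *)
Definition pm1_plus_pow2_odd (m : int) (j : nat) : Prop :=
  exists2 r : int, ~~ (2 %| r)%Z
    & m = 1 + 2 ^+ j * r \/ m = -1 + 2 ^+ j * r.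

(* Main.v *)
Require Import Defs.
From mathcomp Require Import all_boot all_order all_algebra.
From mathcomp Require Import zify ring lra.

(** Write v for the 2-adic valuation. The two factors x - m and x m - 1 are
    tied together by m (x - m) - (x m - 1) = - (m ^+ 2 - 1), where m is a unit
    modulo 2 ^+ k. Hence d = v(m ^+ 2 - 1) decides which x solve the
    congruence.

    - If 2 * d >= k, both factors are congruent (up to a unit) modulo
      2 ^+ uphalf k, so their product is divisible by 2 ^+ k exactly when
      x = m modulo 2 ^+ uphalf k ([dvdz_exp2M_near]). This is one residue
      class, with 2 ^ k./2 representatives ([L_near]).
    - If 2 * d < k, one of the two factors has valuation at most d, so the
      other one is divisible by 2 ^+ (k - d), and conversely
      ([dvdz_exp2M_far]). The solutions form the classes of m and of its
      inverse modulo 2 ^+ (k - d). These classes are disjoint since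
      2 ^+ (k - d) does not divide m ^+ 2 - 1, and each has 2 ^ d
      representatives ([L_far]).

    For m = +-1 + 2 ^+ j * r with r odd and j >= 2 the valuation d is j + 1
    ([pm1_sqr_sub1]), so the inequality 2 * d < k reads j < k / 2 - 1, while
    the values j = k / 2 - 1 and j = (k - 1) / 2 fall under 2 * d >= k. So does
    m = +-1 modulo 2 ^+ uphalf k, as m ^+ 2 - 1 = (m - 1) (m + 1). That every
    odd m is covered comes from 4 dividing one of m - 1 and m + 1
    ([odd_int_cases]). *)

Set Implicit Arguments.
Unset Strict Implicit.
Unset Printing Implicit Defensive.

Import Order.TTheory GRing.Theory Num.Theory.

Local Open Scope ring_scope.

(** * Powers of two and odd integers *)

Lemma Posz_exp2 (k : nat) : (2 ^ k)%N%:Z = 2 ^+ k.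
Proof. by rewrite -[LHS]natz natrX. Qed.

Lemma odd_absz (a : int) : ~~ (2 %| a)%Z = odd `|a|%N.
Proof. by rewrite dvdzE dvdn2 negbK. Qed.

Lemma coprimez_exp2 (e : nat) (a : int) :
  ~~ (2 %| a)%Z -> coprimez (2 ^+ e) a.
Proof. by move=> ao; rewrite coprimezE abszX coprimeXl // coprime2n -odd_absz. Qed.

Lemma dvd2_sub_odd (x : nat) (m : int) :
  ~~ (2 %| m)%Z -> (2 %| x%:Z - m)%Z -> odd x.
Proof. lia. Qed.

Lemma dvd2_mul_odd (x : nat) (m : int) : (2 %| x%:Z * m - 1)%Z -> odd x.
Proof.
apply: contraLR; rewrite -dvdn2 => /dvdnP[q ->].
have -> : (q * 2)%N%:Z * m = 2 * (q%:Z * m) by lia.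
by move: (q%:Z * m) => z; lia.
Qed.

(** * Divisibility of a product by a power of two *)

(** Valuations add: v(A) < i and v(A) + v(B) >= k force v(B) > k - i. In this
    form the zero factors, which have no valuation, need no exception. *)
Lemma dvdz_exp2M_or (k i : nat) (A B : int) : (2 ^+ k %| A * B)%Z ->
  (2 ^+ i %| A)%Z || (2 ^+ (k.+1 - i) %| B)%Z.
Proof.
have [->|A0] := eqVneq A 0; first by rewrite dvdz0.
have [->|B0] := eqVneq B 0; first by rewrite dvdz0 orbT.
rewrite !dvdzE !abszX abszM.
rewrite !pfactor_dvdn ?muln_gt0 ?absz_gt0 ?A0 ?B0 // lognM ?absz_gt0 //.
by lia.
Qed.

Lemma dvdz_exp2_le (i j : nat) (A : int) : (i <= j)%N ->
  (2 ^+ j %| A)%Z -> (2 ^+ i %| A)%Z.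
Proof. by move=> ij; apply: dvdz_trans; apply: dvdz_exp2l. Qed.

(** If 2 ^+ uphalf k does not divide A, then A and B have the same valuation,
    which is less than uphalf k, and the product misses 2 ^+ k. *)
Lemma dvdz_exp2M_near (k : nat) (A B : int) :
  (2 ^+ uphalf k %| A - B)%Z ->
  (2 ^+ k %| A * B)%Z = (2 ^+ uphalf k %| A)%Z.
Proof.
move=> AB; have eqAB : (2 ^+ uphalf k %| B)%Z = (2 ^+ uphalf k %| A)%Z.
  by rewrite -[A in RHS](subrK B) rpredDl.
apply/idP/idP => [/(dvdz_exp2M_or (uphalf k))/orP[//|]|hA].
  by rewrite -eqAB; apply: dvdz_exp2_le; lia.
apply: (@dvdz_exp2_le _ (uphalf k + uphalf k)); first lia.
by rewrite exprD dvdz_mul // eqAB.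
Qed.

(** As v(A - B) = d, the factors A and B cannot both be divisible by
    2 ^+ d.+1; the one with valuation at most d leaves at least k - d to the
    other. Conversely, k - d > d, so a factor divisible by 2 ^+ (k - d) makes
    the other one divisible by 2 ^+ d. *)
Lemma dvdz_exp2M_far (k d : nat) (A B s : int) :
  (d.*2 < k)%N -> ~~ (2 %| s)%Z -> A - B = 2 ^+ d * s ->
  (2 ^+ k %| A * B)%Z = (2 ^+ (k - d) %| A)%Z || (2 ^+ (k - d) %| B)%Z.
Proof.
move=> dk so AB.
have ABd : (2 ^+ d %| A - B)%Z by rewrite AB dvdz_mulr.
have eqAB : (2 ^+ d %| B)%Z = (2 ^+ d %| A)%Z.
  by rewrite -[A in RHS](subrK B) rpredDl.
have kE : (2 ^+ k : int) = 2 ^+ (k - d) * 2 ^+ d.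
  by rewrite -exprD subnK //; lia.
apply/idP/orP => [kAB|[h|h]]; last first.
- rewrite kE mulrC dvdz_mul // -eqAB; apply: dvdz_exp2_le h; lia.
- rewrite kE dvdz_mul // eqAB; apply: dvdz_exp2_le h; lia.
have kdE : (k.+1 - (k - d) = d.+1)%N by lia.
(* Use both orders of the factors: if neither is divisible by 2 ^+ (k - d),
   then both, hence their difference, are divisible by 2 ^+ d.+1. *)
have := dvdz_exp2M_or (k - d) kAB; rewrite kdE => /orP[|hB]; first by left.
move: kAB; rewrite mulrC => /(dvdz_exp2M_or (k - d)).
rewrite kdE => /orP[|hA]; first by right.
have := rpredB hA hB; rewrite AB exprSr dvdz_mul2l ?expf_neq0 //.
by rewrite (negPf so).
Qed.

(** * Counting residue classes *)

Lemma count_residue_block (D : nat) (a : int) (t : nat) : (0 < D)%N ->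
  count (fun x => (D%:Z %| x%:Z - a)%Z) (iota t D) = 1%N.
Proof.
move=> D0; pose y := `|((a - t%:Z) %% D%:Z)%Z|%N.
have yE : y%:Z = ((a - t%:Z) %% D%:Z)%Z by rewrite gez0_abs ?modz_ge0 //; lia.
have yD : (y < D)%N by rewrite -ltz_nat yE ltz_pmod.
rewrite (@eq_in_count _ _ (pred1 (t + y)%N)).
  by rewrite count_uniq_mem ?iota_uniq // mem_iota leq_addr ltn_add2l yD.
move=> x; rewrite mem_iota => /andP[tx xD] /=.
have -> : x%:Z - a = (x - t)%N%:Z - (a - t%:Z) by lia.
rewrite -eqz_mod_dvd -yE modz_small; lia.
Qed.

Lemma count_residue (D q : nat) (a : int) : (0 < D)%N ->
  count (fun x => (D%:Z %| x%:Z - a)%Z) (iota 1 (q * D)) = q.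
Proof.
move=> D0; elim: q => // q IHq.
by rewrite mulSn addnC iotaD count_cat IHq count_residue_block // addn1.
Qed.

Lemma count_residue_exp2 (k c : nat) (a : int) : (c <= k)%N ->
  count (fun x => (2 ^+ c %| x%:Z - a)%Z) (iota 1 (2 ^ k)) = (2 ^ (k - c))%N.
Proof.
move=> ck; rewrite -{1}(subnK ck) expnD -Posz_exp2.
by rewrite count_residue ?expn_gt0.
Qed.

(** * Reduction of L to residue classes *)

Lemma L_count (m : int) (n : nat) : L m n =
  count (fun x => coprime x n && (n%:Z %| (x%:Z - m) * (x%:Z * m - 1))%Z)
    (iota 1 n).
Proof.
rewrite /L cardsE cardE /enum_mem size_filter.
rewrite -(@count_map _ _ val (fun x : nat => [&& (1 <= x)%N, coprime x n
  & ((x%:Z - m) * (x%:Z * m - 1) == 0 %[mod n%:Z])%Z])).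
rewrite -enumT val_enum_ord /= add0n.
apply: eq_in_count => x; rewrite mem_iota => /andP[-> _] /=.
by rewrite eqz_mod_dvd subr0.
Qed.

(** When k > 0, coprimality to 2 ^ k is oddness, so it drops out as soon as
    the congruence forces x to be odd. *)
Lemma L_exp2 (k : nat) (m : int) (P : pred nat) : (0 < k)%N ->
  (forall x, P x -> odd x) ->
  (forall x : nat, (2 ^+ k %| (x%:Z - m) * (x%:Z * m - 1))%Z = P x) ->
  L m (2 ^ k) = count P (iota 1 (2 ^ k)).
Proof.
move=> k0 Podd eqP; rewrite L_count; apply: eq_count => x /=.
by rewrite Posz_exp2 eqP coprime_pexpr // coprimen2 andb_idl // => /Podd.
Qed.

(** Multiplying x - m by the unit m does not change its divisibility by powers
    of two, and makes the difference with x m - 1 independent of x. *)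
Lemma dvdz_quadratic_far (m : int) (d k : nat) (s : int) (hk : (d.*2 < k)%N) :
  ~~ (2 %| m)%Z -> ~~ (2 %| s)%Z -> m ^+ 2 - 1 = 2 ^+ d * s ->
  forall x : nat, (2 ^+ k %| (x%:Z - m) * (x%:Z * m - 1))%Z =
  (2 ^+ (k - d) %| x%:Z - m)%Z || (2 ^+ (k - d) %| x%:Z * m - 1)%Z.
Proof.
move=> mo so mE x.
rewrite -(Gauss_dvdzr _ (coprimez_exp2 k mo)) mulrA.
rewrite (@dvdz_exp2M_far k d _ _ (- s)) ?rpredN //; last first.
  by rewrite mulrN -mE; ring.
by rewrite (Gauss_dvdzr _ (coprimez_exp2 _ mo)).
Qed.

Lemma dvdz_quadratic_near (m : int) (k : nat) :
  ~~ (2 %| m)%Z -> (2 ^+ uphalf k %| m ^+ 2 - 1)%Z ->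
  forall x : nat, (2 ^+ k %| (x%:Z - m) * (x%:Z * m - 1))%Z =
  (2 ^+ uphalf k %| x%:Z - m)%Z.
Proof.
move=> mo mE x.
rewrite -(Gauss_dvdzr _ (coprimez_exp2 k mo)) mulrA.
rewrite dvdz_exp2M_near ?(Gauss_dvdzr _ (coprimez_exp2 _ mo)) //.
have -> : m * (x%:Z - m) - (x%:Z * m - 1) = - (m ^+ 2 - 1) by ring.
by rewrite rpredN.
Qed.

(** * The two regimes *)

Lemma L_near (m : int) (k : nat) : (0 < k)%N ->
  ~~ (2 %| m)%Z -> (2 ^+ uphalf k %| m ^+ 2 - 1)%Z ->
  L m (2 ^ k) = (2 ^ k./2)%N.
Proof.
move=> k0 mo mE; rewrite (L_exp2 k0 _ (dvdz_quadratic_near mo mE)).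
  rewrite count_residue_exp2; last lia.
  by congr (2 ^ _)%N; lia.
by move=> x h; apply: (dvd2_sub_odd mo); apply: (@dvdz_exp2_le 1) h; lia.
Qed.

(** The class of the zeros of x m - 1 is turned into the class of a Bezout
    inverse v of m. A common element x of the two classes would give
    m ^+ 2 = x m = 1 modulo 2 ^+ (k - d), against k - d > d. *)
Lemma L_far (m : int) (d k : nat) (s : int) : (d.*2 < k)%N ->
  ~~ (2 %| m)%Z -> ~~ (2 %| s)%Z -> m ^+ 2 - 1 = 2 ^+ d * s ->
  L m (2 ^ k) = (2 ^ d.+1)%N.
Proof.
move=> dk mo so mE; have k0 : (0 < k)%N by lia.
rewrite (L_exp2 k0 _ (dvdz_quadratic_far dk mo so mE)); last first.
  move=> x /orP[] h.
    by apply: (dvd2_sub_odd mo); apply: (@dvdz_exp2_le 1) h; lia.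
  by apply: (@dvd2_mul_odd x m); apply: (@dvdz_exp2_le 1) h; lia.
set D : int := 2 ^+ (k - d).
have [u [v uv]] : exists u v : int, u * D + v * m = 1.
  have [u [v]] := Bezoutz D m.
  by rewrite (eqP (coprimez_exp2 (k - d) mo)) => uvE; exists u, v.
have Dvm : (D %| v * m - 1)%Z.
  by apply/dvdzP; exists (- u); rewrite -uv; ring.
have invE (x : nat) : (D %| x%:Z * m - 1)%Z = (D %| x%:Z - v)%Z.
  rewrite -[RHS](Gauss_dvdzr _ (coprimez_exp2 (k - d) mo)) -/D.
  have -> : m * (x%:Z - v) = (x%:Z * m - 1) - (v * m - 1) by ring.
  by rewrite [RHS]rpredBr.
have disj (x : nat) : (D %| x%:Z - m)%Z && (D %| x%:Z * m - 1)%Z = false.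
  apply/negP => /andP[h1 h2].
  have : (2 ^+ d.+1 %| m ^+ 2 - 1)%Z.
    apply: (@dvdz_exp2_le _ (k - d)); first lia.
    have -> : m ^+ 2 - 1 = (x%:Z * m - 1) - (x%:Z - m) * m by ring.
    by rewrite rpredB // dvdz_mulr.
  by rewrite mE exprSr dvdz_mul2l ?expf_neq0 // (negPf so).
(* Adding the null count of the intersection turns the count of the union into
   the sum of the two counts. *)
rewrite -[LHS]addn0 -[X in (_ + X)%N](count_pred0 (iota 1 (2 ^ k))).
rewrite -(eq_count disj) count_predUI.
rewrite (eq_count invE) !count_residue_exp2 ?leq_subr //.
by rewrite subKn ?expnS; lia.
Qed.

(** * The shape of m *)

(** With e = +-1, m ^+ 2 - 1 = 2 ^+ j.+1 * (r * (e + 2 ^+ j.-1 * r)), where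
    the last factor is odd because j.-1 > 0; for j = 1 this would fail. *)
Lemma pm1_sqr_sub1 (m : int) (j : nat) : (2 <= j)%N ->
  pm1_plus_pow2_odd m j ->
  exists2 s : int, ~~ (2 %| s)%Z & m ^+ 2 - 1 = 2 ^+ j.+1 * s.
Proof.
case: j => [|[|j]] // _ [r ro mE].
have so (e : int) : ~~ (2 %| e)%Z -> ~~ (2 %| r * (e + 2 ^+ j.+1 * r))%Z.
  move=> eo; rewrite !odd_absz in ro eo *.
  by rewrite abszM oddM ro -odd_absz exprS -mulrA; lia.
case: mE => ->; [exists (r * (1 + 2 ^+ j.+1 * r))|
                 exists (r * (-1 + 2 ^+ j.+1 * r))];
  by [apply: so | rewrite !exprS; ring].
Qed.

(** Among m - 1 and m + 1, take the one divisible by 4: if it is not divisible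
    by 2 ^+ h, its valuation is the required j. *)
Lemma odd_int_cases (m : int) (h : nat) : ~~ (2 %| m)%Z ->
  [\/ (2 ^+ h %| m - 1)%Z, (2 ^+ h %| m + 1)%Z |
     exists j, [/\ pm1_plus_pow2_odd m j, (2 <= j)%N & (j < h)%N]].
Proof.
move=> mo.
have key (a : int) : (4 %| a)%Z -> ~~ (2 ^+ h %| a)%Z ->
    exists2 r : int, ~~ (2 %| r)%Z &
    exists j, [/\ a = 2 ^+ j * r, (2 <= j)%N & (j < h)%N].
  move=> a4 ah; have a0 : a != 0 by apply: contraNneq ah => ->; rewrite dvdz0.
  have vE e : (2 ^+ e %| a)%Z = (e <= logn 2 `|a|)%N.
    by rewrite dvdzE abszX pfactor_dvdn // absz_gt0.
  pose j := logn 2 `|a|%N.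
  have /dvdzP[r aE] : (2 ^+ j %| a)%Z by rewrite vE.
  exists r.
    apply/negP => /dvdzP[q rE].
    have : (2 ^+ j.+1 %| a)%Z by rewrite aE rE exprS -mulrA dvdz_mull.
    by rewrite vE ltnn.
  by exists j; rewrite mulrC -aE -(vE 2%N) ltnNge -vE.
have [h1|h1] := boolP (2 ^+ h %| m - 1)%Z; first by constructor 1.
have [h2|h2] := boolP (2 ^+ h %| m + 1)%Z; first by constructor 2.
constructor 3; have /orP[m4|m4] : (4 %| m - 1)%Z || (4 %| m + 1)%Z by lia.
  have [r ro [j [mE j2 jh]]] := key _ m4 h1.
  by exists j; split=> //; exists r => //; left; rewrite -mE; ring.
have [r ro [j [mE j2 jh]]] := key _ m4 h2.
by exists j; split=> //; exists r => //; right; rewrite -mE; ring.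
Qed.

Lemma eqz_pm1_mod (m D : int) :
  ((m = 1 %[mod D])%Z \/ (m = -1 %[mod D])%Z) <->
  ((D %| m - 1)%Z || (D %| m + 1)%Z).
Proof.
rewrite -!eqz_mod_dvd -[X in (_ || (D %| m + X)%Z)]opprK -eqz_mod_dvd.
by split=> [[] ->|/orP[]/eqP]; rewrite ?eqxx ?orbT //; [left|right].
Qed.

Theorem theorem3 (k : nat) (m : int) (hk : (0 < k)%N)
    (hodd : ~~ (2 %| m)%Z) (hm : 1 <= m <= 2 ^+ k) :
  [/\ (m = 1 %[mod 2 ^+ uphalf k])%Z \/ (m = -1 %[mod 2 ^+ uphalf k])%Z ->
        L m (2 ^ k)%N = (2 ^ k./2)%N,
      forall j : nat, pm1_plus_pow2_odd m j ->
        (2 <= j)%N -> j%:R < k%:R / 2 - 1 :> rat ->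
        L m (2 ^ k)%N = (2 ^ (j + 2))%N,
      forall j : nat, pm1_plus_pow2_odd m j ->
        (2 <= j)%N -> j%:R = k%:R / 2 - 1 :> rat ->
        L m (2 ^ k)%N = (2 ^ (j + 1))%N,
      forall j : nat, pm1_plus_pow2_odd m j ->
        (2 <= j)%N -> j%:R = (k%:R - 1) / 2 :> rat ->
        L m (2 ^ k)%N = (2 ^ j)%N
    & (m = 1 %[mod 2 ^+ uphalf k])%Z \/ (m = -1 %[mod 2 ^+ uphalf k])%Z \/
      exists j : nat, [/\ pm1_plus_pow2_odd m j, (2 <= j)%N
        & [\/ j%:R < k%:R / 2 - 1 :> rat, j%:R = k%:R / 2 - 1 :> rat
            | j%:R = (k%:R - 1) / 2 :> rat]]].
Proof.
have lt_ratE (j : nat) : (j%:R < k%:R / 2 - 1 :> rat) = (j.+1.*2 < k)%N.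
  rewrite -(ltr_nat rat) -muln2 natrM -(natr1 j).
  by apply/idP/idP => ?; lra.
have eq_even_ratE (j : nat) : j%:R = k%:R / 2 - 1 :> rat <-> k = j.+1.*2.
  split=> [h|->]; last by rewrite -muln2 natrM -(natr1 j); lra.
  apply/eqP; rewrite -(eqr_nat rat) -muln2 natrM -(natr1 j); apply/eqP; lra.
have eq_odd_ratE (j : nat) : j%:R = (k%:R - 1) / 2 :> rat <-> k = j.*2.+1.
  split=> [h|->]; last by rewrite -(natr1 j.*2) -muln2 natrM; lra.
  apply/eqP; rewrite -(eqr_nat rat) -(natr1 j.*2) -muln2 natrM; apply/eqP; lra.
have near (j : nat) : pm1_plus_pow2_odd m j -> (2 <= j)%N ->
    (uphalf k <= j.+1)%N -> L m (2 ^ k) = (2 ^ k./2)%N.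
  move=> mj j2 kj; have [s _ mE] := pm1_sqr_sub1 j2 mj.
  by apply: L_near => //; rewrite mE dvdz_mulr // dvdz_exp2l.
split=> [mE|j mj j2|j mj j2|j mj j2|].
- apply: L_near => //; have -> : m ^+ 2 - 1 = (m - 1) * (m + 1) by ring.
  by move/eqz_pm1_mod: mE => /orP[h|h]; [apply: dvdz_mulr|apply: dvdz_mull].
- rewrite lt_ratE => jk; have [s so mE] := pm1_sqr_sub1 j2 mj.
  by rewrite (L_far jk hodd so mE) addn2.
- move/eq_even_ratE => kE; rewrite (near j mj j2); last lia.
  by congr (2 ^ _)%N; lia.
- move/eq_odd_ratE => kE; rewrite (near j mj j2); last lia.
  by congr (2 ^ _)%N; lia.
have [h|h|[j [mj j2 jk]]] := odd_int_cases (uphalf k) hodd.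
- by left; apply/eqP; rewrite eqz_mod_dvd.
- by right; left; apply/eqP; rewrite eqz_mod_dvd opprK.
right; right; exists j; split=> //.
have [kE|k_ne] := eqVneq k j.*2.+1; first by constructor 3; apply/eq_odd_ratE.
have [kE|k_ne'] := eqVneq k j.+1.*2; first by constructor 2; apply/eq_even_ratE.
by constructor 1; rewrite lt_ratE; lia.
Qed.
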